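(* For any complete bipartite graph $K_{s,t}$ with integers $t\geq s\geq 3$, we have $2\leq px_3(K_{s,t})\leq 3$.
   Context: All graphs are simple, finite, undirected and connected. $K_{s,t}$ denotes the complete bipartite graph with partite sets of sizes $s$ and $t$. An edge-coloring of a graph $G$ is any map $c:E(G)\to\{1,\dots,m\}$, $m\in\mathbb{N}$ (adjacent edges may receive the same color). A tree $T$ that is a subgraph of an edge-colored graph $G$ is a proper tree if no two adjacent edges of $T$ are assigned the same color. For $S\subseteq V(G)$, an $S$-tree is a tree that is a subgraph of $G$ and contains all vertices of $S$. For a connected graph $G$ of order $n$ and an integer $k$ with $2\le k\le n$, a $k$-proper coloring of $G$ is an edge-coloring such that for every set $S$ of $k$ vertices of $G$ there exists a proper $S$-tree in $G$. The $k$-proper index $px_k(G)$ is the minimum number of colors required in a $k$-proper coloring of $G$. *)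

(* Defs.v *)
From mathcomp Require Import all_boot.
From mathcomp Require Import boolp.
Set Implicit Arguments. Unset Strict Implicit. Unset Printing Implicit Defensive.

Record sgraph := SGraph {
  vertex :> finType;
  adj : rel vertex;
  adj_sym : symmetric adj;
  adj_irrefl : irreflexive adj }.

Definition edges (G : sgraph) : {set {set G}} :=
  [set [set p.1; p.2] | p : G * G & adj p.1 p.2].

Definition edge (G : sgraph) := {e : {set G} | e \in edges G}.

(* The colours 1, ..., m are represented by the elements of 'I_m. *)
Definition edge_coloring (G : sgraph) (m : nat) := edge G -> 'I_m.

(* A subgraph of G is given by its vertex set W and its edge set F. *)
Definition is_subgraph (G : sgraph) (W : {set G}) (F : {set {set G}}) : Prop :=
  F \subset edges G /\ (forall e, e \in F -> e \subset W).

Definition sub_adj (G : sgraph) (F : {set {set G}}) : rel G :=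
  [rel x y | [set x; y] \in F].

(* The edges of F lie inside W, so walks along F that start in W stay in W. *)
Definition sub_connected (G : sgraph) (W : {set G}) (F : {set {set G}}) : Prop :=
  forall x y, x \in W -> y \in W -> connect (sub_adj F) x y.

Definition sub_acyclic (G : sgraph) (F : {set {set G}}) : Prop :=
  forall p : seq G, 2 < size p -> ~ ucycle (sub_adj F) p.

Definition is_subtree (G : sgraph) (W : {set G}) (F : {set {set G}}) : Prop :=
  [/\ is_subgraph W F, W != set0, sub_connected W F & sub_acyclic F].

Definition is_proper (G : sgraph) (m : nat) (c : edge_coloring G m)
    (F : {set {set G}}) : Prop :=
  forall e f : edge G, val e \in F -> val f \in F ->
    e != f -> val e :&: val f != set0 -> c e <> c f.

Definition k_proper_coloring (k : nat) (G : sgraph) (m : nat)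
    (c : edge_coloring G m) : Prop :=
  forall S : {set G}, #|S| = k ->
    exists (W : {set G}) (F : {set {set G}}),
      [/\ is_subtree W F, S \subset W & is_proper c F].

Definition k_proper_colorable (k : nat) (G : sgraph) (m : nat) : Prop :=
  exists c : edge_coloring G m, k_proper_coloring k c.

(* The least number of colours of a k-proper coloring of G. The value 0 when
   there is no such coloring is a junk value: this does not happen for a
   connected G with 2 <= k <= #|G|, and in that range the minimum is positive. *)
Definition proper_index (k : nat) (G : sgraph) : nat :=
  if pselect (exists m, `[< k_proper_colorable k G m >]) is left ex_m
  then ex_minn ex_m else 0.

Definition bip_adj (s t : nat) : rel ('I_s + 'I_t) :=
  fun x y => match x, y with
             | inl _, inr _ | inr _, inl _ => true
             | _, _ => false
             end.

Lemma bip_adj_sym s t : symmetric (@bip_adj s t).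
Proof. by case=> ? [] ?. Qed.

Lemma bip_adj_irrefl s t : irreflexive (@bip_adj s t).
Proof. by case. Qed.

Definition complete_bipartite (s t : nat) : sgraph :=
  SGraph (@bip_adj_sym s t) (@bip_adj_irrefl s t).

(* Main.v *)
(** Split each side of the bipartition into three nonempty classes indexed by
  Z/3Z, and colour an edge with the sum of the classes of its ends.  A subgraph
  is then properly coloured as soon as the neighbours of each vertex lie in
  different classes.  Any three vertices lie in such a star, in such a path with
  at most five vertices, or, when they have the same side and the same class, in
  such a spider with three legs of length two, whose centre is on their side but
  in another class.
  Conversely, with at most one colour the edges of a proper tree are disjoint,
  so that it has at most two vertices. *)
Require Import Defs.
From mathcomp Require Import all_boot.
From mathcomp Require Import ssralg zmodp boolp.
Set Implicit Arguments. Unset Strict Implicit. Unset Printing Implicit Defensive.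

(** * Two-element sets and edges *)

Lemma set2_eq_l (T : finType) (x y z : T) : [set x; y] = [set x; z] -> y = z.
Proof.
move=> /setP eq_xyz; have := eq_xyz y; rewrite !inE eqxx orbT.
case: (eqVneq y x) => [y_x _|_] /=; last by move/esym/eqP.
by have := eq_xyz z; rewrite y_x !inE eqxx !orbT => /orP[] /eqP ->.
Qed.

Lemma card_set3 (T : finType) (x y z : T) :
  x != y -> y != z -> z != x -> #|[set x; y; z]| = 3.
Proof.
move=> neq_xy neq_yz neq_zx.
by rewrite setUC cardsU1 cards2 !inE neq_xy negb_or neq_zx eq_sym neq_yz.
Qed.

Lemma edges_set2 (G : sgraph) (x y : G) : ([set x; y] \in edges G) = adj x y.
Proof.
apply/imsetP/idP => [[[u v] /= uv eq_xy]|xy]; last first.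
  by exists (x, y); rewrite ?inE.
have /set2P[x_u|x_v] : x \in [set u; v] by rewrite -eq_xy set21.
  by move: eq_xy uv; rewrite inE /= x_u => /set2_eq_l ->.
by move: eq_xy uv; rewrite inE /= x_v [in RHS]setUC adj_sym => /set2_eq_l ->.
Qed.

Lemma edge_containing (G : sgraph) (e : {set G}) (x : G) :
  e \in edges G -> x \in e -> exists2 y, e = [set x; y] & adj x y.
Proof.
case/imsetP=> -[u v]; rewrite inE /= => uv -> /set2P[] ->; first by exists v.
by exists u; rewrite 1?setUC 1?adj_sym.
Qed.

Lemma sub_adjE (G : sgraph) (F : {set {set G}}) (x y : G) :
  sub_adj F x y = ([set x; y] \in F).
Proof. by []. Qed.

Lemma sub_adjC (G : sgraph) (F : {set {set G}}) : symmetric (sub_adj F).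
Proof. by move=> x y; rewrite !sub_adjE setUC. Qed.

(** * Proper trees under at most one colour *)

Section LowerBound.

Variables (G : sgraph) (m : nat) (c : edge_coloring G m).
Hypothesis m_le1 : m <= 1.

Lemma proper_monochrome_adj (F : {set {set G}}) (x y z : G) :
  F \subset edges G -> is_proper c F ->
  sub_adj F x y -> sub_adj F x z -> y = z.
Proof.
move=> FG Fc xy xz; apply: (@set2_eq_l _ x); apply/eqP/negPn/negP => neq_yz.
pose e : edge G := exist (fun e => e \in edges G) _ (subsetP FG _ xy).
pose f : edge G := exist (fun e => e \in edges G) _ (subsetP FG _ xz).
have/(Fc e f xy xz): e != f by rewrite -val_eqE.
case; first by apply/set0Pn; exists x; rewrite inE !set21.
(* No colour exists in ['I_0], and any two colours in ['I_1] are equal. *)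
case: m m_le1 (c e) (c f) => [|[|//]] _ i j; first by case: i.
by rewrite (ord1 i) (ord1 j).
Qed.

(** Every vertex has at most one neighbour along [F], so a walk from [x] only runs back and forth on
    a single edge; [y] and [z] must both be its other end. *)
Lemma proper_monochrome_subtree (W : {set G}) (F : {set {set G}}) (x y z : G) :
  is_subtree W F -> is_proper c F -> x \in W -> y \in W -> z \in W ->
  x != y -> x != z -> y = z.
Proof.
move=> [[FG _] _ Fconn _] Fc Wx Wy Wz neq_xy neq_xz.
have adj_uniq := proper_monochrome_adj FG Fc.
have step p u v : sub_adj F u v -> path (sub_adj F) u p ->
    last u p = u \/ last u p = v.
  elim: p u v => [|w p IHp] u v uv /=; first by left.
  case/andP=> uw; rewrite (adj_uniq _ _ _ uw uv) => /(IHp v u) [|->|->];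
    by [rewrite sub_adjC | right | left].
have reach w : w \in W -> x != w -> sub_adj F x w.
  move=> Ww neq_xw; have /connectP[[|v p] /= p_path def_w] := Fconn x w Wx Ww.
    by rewrite def_w eqxx in neq_xw.
  have /andP[xv _] := p_path.
  case: (step (v :: p) x v xv p_path) => /= last_p; rewrite -def_w in last_p.
    by rewrite last_p eqxx in neq_xw.
  by rewrite last_p.
by apply: (adj_uniq x); apply: reach.
Qed.

End LowerBound.

Lemma k_proper_colorable3_gt1 (G : sgraph) (m : nat) :
  2 < #|G| -> k_proper_colorable 3 G m -> 1 < m.
Proof.
move=> /card_gt2P[x [y [z [_ [neq_xy neq_yz neq_zx]]]]] [c c_proper].
rewrite ltnNge; apply/negP => m_le1.
have [|W [F [FW SW Fc]]] := c_proper [set x; y; z].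
  exact: card_set3.
move: SW; rewrite !subUset !sub1set -andbA => /and3P[Wx Wy Wz].
have := proper_monochrome_subtree m_le1 FW Fc Wx Wy Wz neq_xy.
by rewrite eq_sym => /(_ neq_zx) eq_yz; rewrite eq_yz eqxx in neq_yz.
Qed.

(** * Building trees leaf by leaf *)

Section GrowingTrees.

Variable G : sgraph.
Implicit Types (W : {set G}) (F : {set {set G}}) (x y z : G).

Lemma is_subtree1 x : is_subtree [set x] set0.
Proof.
split.
- by split; [exact: sub0set | move=> e; rewrite inE].
- by apply/set0Pn; exists x; rewrite set11.
- by move=> u v /set1P -> /set1P ->; exact: connect0.
- by case=> [|u [|v p]] //= _ /andP[/= /andP[]]; rewrite sub_adjE inE.
Qed.

Lemma is_subtree_leaf W F x y : is_subtree W F -> x \in W -> y \notin W ->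
  adj x y -> is_subtree (y |: W) ([set x; y] |: F).
Proof.
move=> [[FG FW] _ Fconn Facyc] Wx W'y xy.
have adjW u v : sub_adj F u v -> (u \in W) && (v \in W).
  by move/FW; rewrite subUset !sub1set.
split.
- split; first by rewrite subUset sub1set edges_set2 xy.
  move=> e /setU1P[->|/FW eW]; last by rewrite (subset_trans eW) ?subsetUr.
  by rewrite subUset !sub1set !inE eqxx Wx orbT.
- by apply/set0Pn; exists y; rewrite setU11.
- have F'C : connect_sym (sub_adj ([set x; y] |: F)).
    exact/sym_connect_sym/sub_adjC.
  have to_x u : u \in y |: W -> connect (sub_adj ([set x; y] |: F)) x u.
    case/setU1P=> [->|Wu]; first by apply: connect1; rewrite sub_adjE setU11.
    apply: connect_sub (Fconn _ _ Wx Wu) => v w vw.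
    by apply: connect1; apply/setU1P; right.
  move=> u v /to_x xu /to_x xv; apply: connect_trans xv.
  by rewrite F'C.
move=> p size_p /andP[p_cycle p_uniq].
(* The new vertex [y] is a leaf: [x] is its only neighbour. *)
have nbr_y u : [set y; u] \in [set x; y] |: F -> u = x.
  case/setU1P=> [|/adjW]; last by rewrite (negPf W'y).
  by rewrite [in RHS]setUC => /set2_eq_l.
have [p_y|p'y] := boolP (y \in p); last first.
  (* A cycle that avoids [y] uses only old edges. *)
  apply: (Facyc p size_p); rewrite /ucycle p_uniq andbT.
  apply: (sub_in_cycle (P := [pred u | u != y])) p_cycle.
    move=> u v neq_uy neq_vy /setU1P[] // eq_uv.
    have : y \in [set u; v] by rewrite eq_uv set22.
    by rewrite !inE eq_sym (negPf neq_uy) eq_sym (negPf neq_vy).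
  by apply/allP => u p_u /=; apply: contraNneq p'y => <-.
(* Rotated to start at [y], the cycle has [x] both as second and as last vertex, although it has
   length at least three and no repetition. *)
have [i q def_q] := rot_to p_y.
move: p_cycle p_uniq size_p; rewrite -(rot_cycle i) -(rot_uniq i).
rewrite -(size_rot i) def_q; case: q {def_q} => [|u [|v q]] //=.
rewrite rcons_path => /and4P[yu _ _ vy] /and3P[_ q'u _] _.
have u_x := nbr_y u yu; have v_x : last v q = x by apply: nbr_y; rewrite setUC.
by move: q'u; rewrite u_x -v_x mem_last.
Qed.

End GrowingTrees.

(** * Colouring edges by sums of vertex classes *)

Section ClassColoring.

Variables (G : sgraph) (n : nat) (cl : G -> 'I_n.+1).
Implicit Types (W : {set G}) (F : {set {set G}}) (r x y z : G).
Implicit Types (l : seq (G * G)).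

(** The sum is taken in Z/(n+1)Z. An edge has exactly two ends, so its colour is the sum of two
    classes. *)
Definition class_coloring : edge_coloring G n.+1 :=
  fun e => (\sum_(x in val e) cl x)%R.

(** For edges [[set x; y]] and [[set x; z]], the class of the common end [x] cancels from an
    equality of colours. *)
Lemma class_coloring_proper F :
  (forall x y z, [set x; y] \in F -> [set x; z] \in F -> y != z ->
     cl y != cl z) ->
  is_proper class_coloring F.
Proof.
move=> cl_inj [e /= eG] [f /= fG] Fe Ff; rewrite -val_eqE /= => neq_ef.
case/set0Pn=> x; rewrite inE => /andP[e_x f_x].
rewrite /class_coloring /=.
have [y def_e xy] := edge_containing eG e_x.
have [z def_f xz] := edge_containing fG f_x.
rewrite {e eG e_x}def_e in Fe neq_ef *; rewrite {f fG f_x}def_f in Ff neq_ef *.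
have neq_adj u : adj x u -> x \notin [set u].
  by rewrite inE; apply: contraTneq => ->; rewrite adj_irrefl.
rewrite !big_setU1 ?neq_adj //= !big_set1 => /GRing.addrI/eqP.
apply/negP/(cl_inj x) => //.
by apply: contraNneq neq_ef => ->.
Qed.

(* [l] lists the edges (parent, child) of a tree with root [r], the last one
   that has been attached coming first. *)
Fixpoint grows r l : bool :=
  if l is (x, y) :: l' then
    [&& grows r l', adj x y, x \in r :: unzip2 l', y \notin r :: unzip2 l' &
        all (fun e => ((e.1 == x) ==> (cl e.2 != cl y)) &&
                      ((e.2 == x) ==> (cl e.1 != cl y))) l']
  else true.

Definition proper_connected (S : {set G}) : Prop :=
  exists (W : {set G}) (F : {set {set G}}),
    [/\ is_subtree W F, S \subset W & is_proper class_coloring F].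

(** Attaching a leaf adds a neighbour only to its parent, and [grows] compares the class of the leaf
    with those of the earlier neighbours of that parent. *)
Lemma grows_proper_connected r l (S : {set G}) :
  grows r l -> {subset S <= r :: unzip2 l} -> proper_connected S.
Proof.
move=> l_grows Sl.
(* The induction must also record that each edge of [F] is listed in [l], in one of its two
   orientations: the test in [grows] only sees listed edges. *)
suff [W [F [FW defW _ Fcl]]] : exists W F, [/\ is_subtree W F,
    W =i r :: unzip2 l,
    forall x z, [set x; z] \in F -> ((x, z) \in l) || ((z, x) \in l) &
    forall x y z, [set x; y] \in F -> [set x; z] \in F -> y != z ->
      cl y != cl z].
  exists W, F; split=> //; last exact: class_coloring_proper.
  by apply/subsetP => x /Sl; rewrite defW.
elim: l l_grows {S Sl} => [_|[x y] l IHl] /=.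
  exists [set r], set0; split; first exact: is_subtree1.
  - by move=> x; rewrite !inE.
  - by move=> x z; rewrite inE.
  - by move=> x y z; rewrite inE.
case/and5P=> /IHl[W [F [FW defW Fl Fcl]]] xy l_x l'y /allP y_cl.
have x_cl z : [set x; z] \in F -> cl z != cl y.
  case/Fl/orP=> /y_cl /andP[/= + +]; rewrite eqxx //=.
have F'y z : [set y; z] \notin F.
  have [[_ F_sub] _ _ _] := FW; apply: contraNN l'y => /F_sub.
  by rewrite -defW subUset sub1set => /andP[].
exists (y |: W), ([set x; y] |: F); split.
- by apply: is_subtree_leaf; rewrite ?defW.
- by move=> z; rewrite !inE defW !inE orbCA.
- move=> u v /setU1P[eq_uv|/Fl]; last first.
    by rewrite !inE => /orP[] ->; rewrite !orbT.
  have /set2P[u_x|u_y] : u \in [set x; y] by rewrite -eq_uv set21.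
    by move: eq_uv; rewrite u_x => /set2_eq_l ->; rewrite mem_head.
  move: eq_uv; rewrite u_y [in RHS]setUC => /set2_eq_l ->.
  by rewrite mem_head orbT.
move=> u v w /setU1P[eq_uv|Fuv] /setU1P[eq_uw|Fuw]; last exact: Fcl Fuv Fuw.
- by rewrite -eq_uw in eq_uv; rewrite (set2_eq_l eq_uv) eqxx.
- have /set2P[u_x|u_y] : u \in [set x; y] by rewrite -eq_uv set21.
    move: eq_uv Fuw; rewrite u_x => /set2_eq_l -> /x_cl.
    by rewrite eq_sym.
  by rewrite u_y (negPf (F'y w)) in Fuw.
have /set2P[u_x|u_y] : u \in [set x; y] by rewrite -eq_uw set21.
  by move: eq_uw Fuv; rewrite u_x => /set2_eq_l -> /x_cl.
by rewrite u_y (negPf (F'y v)) in Fuv.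
Qed.

End ClassColoring.

(** * Three vertices of a complete bipartite graph *)

Section CompleteBipartite.

Variables s t : nat.
Hypotheses (hs : 3 <= s) (ht : 3 <= t).
Notation K := (complete_bipartite s t).

Definition side (x : K) : bool := if x is inl _ then true else false.

Definition residue (x : K) : 'I_3 :=
  match x with inl i => inZp i | inr j => inZp j end.

Lemma bip_adj_side (x y : K) : bip_adj x y = (side x != side y).
Proof. by case: x y => ? []. Qed.

(** The vertex of index [k] serves, as each side has at least three vertices. *)
Lemma exists_side_residue (b : bool) (k : 'I_3) :
  exists x : K, side x = b /\ residue x = k.
Proof.
have lt_k m : 3 <= m -> k < m by apply: leq_trans.
case: b.
  by exists (inl (Ordinal (lt_k s hs))); split; last exact: valZpK.
by exists (inr (Ordinal (lt_k t ht))); split; last exact: valZpK.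
Qed.

Lemma exists_opposite_residue (x : K) (k : 'I_3) :
  exists y : K, side y <> side x /\ residue y = k.
Proof.
have [y [y_side y_k]] := exists_side_residue (~~ side x) k.
by exists y; split=> //; rewrite y_side; case: (side x).
Qed.

Lemma exists_other_residue (k : 'I_3) : exists j : 'I_3, j <> k.
Proof.
have /card_gt0P[j] : 0 < #|~: [set k]| by rewrite cardsC1 card_ord.
by rewrite !inE => /eqP; exists j.
Qed.

Notation connected3 a b c := (proper_connected residue [set a; b; c]).

(** The first edge to be attached is the last in [l]. Vertices are told apart by side, by residue or
    by hypothesis, which [congruence] exploits after case splits. *)
Ltac grow_tree r l :=
  apply: (@grows_proper_connected _ _ _ r l);
  [ rewrite /= !bip_adj_side !inE ?eqxx ?orbT /=;
    repeat (case: eqP => /= ?; try congruence)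
  | move=> z; rewrite !inE => /orP[/orP[]|] /eqP ->; rewrite ?eqxx ?orbT ].

Lemma connected3_cherry (a b c : K) : side a = side b -> side c <> side a ->
  residue a <> residue b -> connected3 a b c.
Proof. by move=> ab ca r_ab; grow_tree a [:: (c, b); (a, c)]. Qed.

Lemma connected3_star (a b c : K) : side a = side b -> side b = side c ->
  residue a <> residue b -> residue b <> residue c -> residue a <> residue c ->
  connected3 a b c.
Proof.
move=> ab bc r_ab r_bc r_ac.
have [u [ua _]] := exists_opposite_residue a ord0.
by grow_tree a [:: (u, c); (u, b); (a, u)].
Qed.

(** The path is [a], [u], [c], [u'], [b]; the distinct residues 0 and 2 of [u] and [u'] separate the
    edges at [c]. *)
Lemma connected3_path_center (a b c : K) : side a = side b -> side b = side c ->
  a <> b -> residue a = residue b -> residue c <> residue a ->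
  connected3 a b c.
Proof.
move=> ab bc neq_ab r_ab r_ca.
have [u [ua r_u]] := exists_opposite_residue a ord0.
have [u' [u'a r_u']] := exists_opposite_residue a ord_max.
have uu' : side u = side u'.
  by case: (side u) (side u') (side a) ua u'a => [] [] [].
have r_uu' : residue u <> residue u' by rewrite r_u r_u'.
by grow_tree a [:: (u', b); (c, u'); (u, c); (a, u)].
Qed.

(** The path is [a], [c], [w], [u], [b]. The vertex [w] differs in residue from [a] and hence from
    [b], and [u] differs from [c]. *)
Lemma connected3_path_off_center (a b c : K) : side a = side b ->
  side c <> side a -> a <> b -> residue a = residue b -> connected3 a b c.
Proof.
move=> ab ca neq_ab r_ab.
have [j neq_j] := exists_other_residue (residue a).
have [w [wa r_w]] := exists_side_residue (side a) j.
have r_wa : residue w <> residue a by rewrite r_w.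
have [k neq_k] := exists_other_residue (residue c).
have [u [uc r_u]] := exists_side_residue (side c) k.
have r_uc : residue u <> residue c by rewrite r_u.
by grow_tree a [:: (u, b); (w, u); (c, w); (a, c)].
Qed.

(** The centre [w] has neighbours [u1], [u2], [u3] of residues 0, 1, 2, which lead to [a], [b],
    [c]. *)
Lemma connected3_spider (a b c : K) : side a = side b -> side b = side c ->
  a <> b -> b <> c -> a <> c ->
  residue a = residue b -> residue b = residue c -> connected3 a b c.
Proof.
move=> ab bc neq_ab neq_bc neq_ac r_ab r_bc.
have [j neq_j] := exists_other_residue (residue a).
have [w [wa r_w]] := exists_side_residue (side a) j.
have r_wa : residue w <> residue a by rewrite r_w.
have [u1 [u1_side r_u1]] := exists_side_residue (~~ side a) ord0.
have [u2 [u2_side r_u2]] := exists_side_residue (~~ side a) (inZp 1).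
have [u3 [u3_side r_u3]] := exists_side_residue (~~ side a) (inZp 2).
have r12 : residue u1 <> residue u2 by rewrite r_u1 r_u2.
have r13 : residue u1 <> residue u3 by rewrite r_u1 r_u3.
have r23 : residue u2 <> residue u3 by rewrite r_u2 r_u3.
have u1a : side u1 <> side a by rewrite u1_side; case: (side a).
by grow_tree a [:: (u3, c); (w, u3); (u2, b); (w, u2); (u1, w); (a, u1)].
Qed.

Lemma connected3_two_sides (a b c : K) : side a = side b ->
  side c <> side a -> a <> b -> connected3 a b c.
Proof.
move=> ab ca neq_ab; case: (eqVneq (residue a) (residue b)) => [r_ab|/eqP r_ab].
  exact: connected3_path_off_center.
exact: connected3_cherry.
Qed.

Lemma set3_CA (T : finType) (a b c : T) : [set a; b; c] = [set b; c; a].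
Proof. by rewrite [RHS]setUC setUA. Qed.

Lemma connected3_one_side (a b c : K) : side a = side b -> side b = side c ->
  a <> b -> b <> c -> a <> c -> connected3 a b c.
Proof.
move=> ab bc neq_ab neq_bc neq_ac.
(* If exactly two residues agree, the triple is permuted to put those two vertices first. *)
case: (eqVneq (residue a) (residue b)) => [r_ab|/eqP r_ab];
case: (eqVneq (residue b) (residue c)) => [r_bc|/eqP r_bc];
case: (eqVneq (residue a) (residue c)) => [r_ac|/eqP r_ac]; try congruence.
- exact: connected3_spider.
- by apply: connected3_path_center => //; congruence.
- by rewrite set3_CA; apply: connected3_path_center; congruence.
- by rewrite setUAC; apply: connected3_path_center; congruence.
- exact: connected3_star.
Qed.

Lemma connected3_distinct (a b c : K) :
  a <> b -> b <> c -> a <> c -> connected3 a b c.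
Proof.
move=> neq_ab neq_bc neq_ac.
case: (eqVneq (side a) (side b)) => [ab|/eqP ab];
case: (eqVneq (side b) (side c)) => [bc|/eqP bc].
- exact: connected3_one_side.
- by apply: connected3_two_sides; congruence.
- by rewrite set3_CA; apply: connected3_two_sides; congruence.
(* There are only two sides, so [a] and [c] are both opposite to [b]. *)
have ac : side a = side c by case: (side a) (side b) (side c) ab bc => [] [] [].
by rewrite setUAC; apply: connected3_two_sides; congruence.
Qed.

Lemma complete_bipartite_3_proper_colorable : k_proper_colorable 3 K 3.
Proof.
exists (class_coloring residue) => S S3.
have /card_gt2P[a [b [c [[Sa Sb Sc] [neq_ab neq_bc neq_ca]]]]] : 2 < #|S|.
  by rewrite S3.
have <- : [set a; b; c] = S.
  apply/eqP; rewrite eqEcard S3 card_set3 // andbT.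
  by rewrite !subUset !sub1set Sa Sb Sc.
by apply: connected3_distinct; apply/eqP; rewrite // eq_sym.
Qed.

End CompleteBipartite.

Theorem theorem2 (s t : nat) (hs : 3 <= s) (hst : s <= t) :
  2 <= proper_index 3 (complete_bipartite s t) <= 3.
Proof.
have K3 := complete_bipartite_3_proper_colorable hs (leq_trans hs hst).
have K_gt2 : 2 < #|complete_bipartite s t|.
  by rewrite card_sum !card_ord ltn_addr.
(* The default value 0 is excluded by the colouring with three colours, which also bounds the
   minimum from above. *)
rewrite /proper_index; case: pselect => [ex_m|[]]; last first.
  by exists 3; apply/asboolP.
case: ex_minnP => m /asboolP/(k_proper_colorable3_gt1 K_gt2) -> /=.
by apply; apply/asboolP.
Qed.
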